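(* Let $\mathsf{F}:X\to X'$ satisfy, for constants $L>0$, $c>0$ and all $x,y,v\in X$, \[ |\mathsf{F}(x)(v)-\mathsf{F}(y)(v)|\le L\|x-y\|_X\|v\|_X,\qquad (\mathsf{F}(x)-\mathsf{F}(y))(x-y)\ge c\|x-y\|_X^2 , \] and let $u\in X$ be the unique solution of $\mathsf{F}(u)=0$ in $X'$. Let $u_h^0\in X_h$, let $\{u_h^n\}_{n\ge 0}\subset X_h$ be defined by $(u_h^{n+1},v_h)_X=\mathsf{B}(u_h^n)(v_h)$ for all $v_h\in X_h$, and let $\eta_h\ge 0$ be such that \[ \left|\mathsf{B}(u_h^n)(v)-(u_h^{n+1},v)_X\right|\le \eta_h\|v\|_X\qquad \forall v\in X,\ \forall n\ge 0 . \] Then, for $e_h^{n+1}:=u-u_h^{n+1}$, $n\ge 0$, there holds the a posteriori error bound \[ \|e_h^{n+1}\|_X\le \frac{L^2}{c^2}\,\eta_h+\frac{L}{c}\left(1+\frac{L}{c}\right)\|u_h^{n+1}-u_h^n\|_X . \]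
   Context: $X$ is a real Hilbert space with inner product $(\cdot,\cdot)_X$ and norm $\|\cdot\|_X$, $X'$ is its dual, and $X_h\subset X$ is a finite dimensional linear subspace. For $t=c/L^2$ the operator $\mathsf{B}$ is defined by $\mathsf{B}(u)(v):=(u,v)_X-t\,\mathsf{F}(u)(v)$ for $u,v\in X$. Under the stated assumptions on $\mathsf{F}$, the equation $\mathsf{F}(u)=0$ has a unique solution $u\in X$. *)

(* Defs.v *)
From HB Require Import structures.
From mathcomp Require Export all_boot all_order all_algebra.
From mathcomp Require Export all_classical all_reals all_analysis.

Export Order.TTheory GRing.Theory Num.Theory.
Export numFieldNormedType.Exports.

Set Implicit Arguments.
Unset Strict Implicit.
Unset Printing Implicit Defensive.

Local Open Scope ring_scope.

(* A real Hilbert space is a complete normed module [X] with a symmetric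
   positive definite bilinear form [ip : {dot X for idfun}] that induces its
   norm, in the sense of [norm_induced_by]. *)
Definition norm_induced_by (R : realType) (X : normedModType R)
    (ip : {dot X for idfun}) : Prop :=
  forall x : X, `|x| = Num.sqrt (ip x x).

(* The dual is topological: continuous linear functionals. The vector space
   operations on it are always written pointwise. *)
Record dual (R : realType) (X : normedModType R) := Dual {
  dual_form :> {scalar X};
  dual_continuous : continuous (dual_form : X -> R)
}.

Definition finite_dimensional (R : realType) (X : lmodType R)
    (S : {pred X}) : Prop :=
  exists (n : nat) (e : 'I_n -> X),
    (forall i, e i \in S) /\
    (forall x, x \in S -> exists a : 'I_n -> R, x = \sum_(i < n) a i *: e i).

Definition opB (R : realType) (X : normedModType R) (ip : {dot X for idfun})
    (F : X -> dual X) (t : R) (u v : X) : R :=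
  ip u v - t * F u v.

(* Main.v *)
Require Import Defs.
From mathcomp Require Import ring lra.

(** Write [w] for the new iterate, [p] for the previous one and [e = u - w].
    Since [F u] vanishes, strong monotonicity bounds [c |e|^2] by [- F w e],
    so it suffices to bound the residual of [w] tested against [e].  Replacing
    [w] by [p] inside [F] costs [L |w - p| |e|] by the Lipschitz condition.  At
    [p] the residual is visible to the iteration: unfolding [B] gives

      - t F(p)(v) = (B(p)(v) - (w, v)) + (w - p, v),

    whose first term is the discretization error, at most [eta |v|], and whose
    second term is at most [|w - p| |v|] by Cauchy-Schwarz.  Taking [v = e] and
    dividing by [c |e|] yields

      |e| <= eta / (t c) + (1 / (t c) + L / c) |w - p|

    for every step size [t > 0] ([error_le_fixed_point_step]); the theorem is
    the case [t = c / L^2]. *)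

Set Implicit Arguments.
Unset Strict Implicit.
Unset Printing Implicit Defensive.

Local Open Scope ring_scope.

Lemma dot_normE (R : realType) (X : normedModType R)
    (ip : {dot X for idfun}) (hip : norm_induced_by ip) (x : X) :
  ip x x = `|x| ^+ 2.
Proof.
rewrite hip sqr_sqrtr //.
have [->|x_neq0] := eqVneq x 0; first by rewrite linear0r.
exact/ltW/neq0_dnorm_gt0.
Qed.

(** Cauchy-Schwarz, in the direction used here.  As [`| |] is already known to
    be a norm, it can be read off from the triangle inequality by expanding
    [`|x + y| ^+ 2 <= (`|x| + `|y|) ^+ 2]. *)
Lemma dot_le_norm (R : realType) (X : normedModType R)
    (ip : {dot X for idfun}) (hip : norm_induced_by ip) (x y : X) :
  ip x y <= `|x| * `|y|.
Proof.
have sq_le : `|x + y| ^+ 2 <= (`|x| + `|y|) ^+ 2.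
  by rewrite lerXn2r ?nnegrE ?addr_ge0 ?normr_ge0 ?ler_normD.
have expand : `|x + y| ^+ 2 = `|x| ^+ 2 + 2 * ip x y + `|y| ^+ 2.
  have ipC : ip y x = ip x y by rewrite hermC expr0 mul1r.
  rewrite -!(dot_normE hip) linearDl !linearDr /= ipC; ring.
move: sq_le; rewrite expand; lra.
Qed.

(** An a posteriori bound for one inexact step [p |-> w] of the fixed point
    iteration with an arbitrary step size [t]: neither [p] nor [w] has to lie
    in a discrete space, as [eta] alone measures how far [w] is from the exact
    step. *)
Lemma error_le_fixed_point_step (R : realType) (X : normedModType R)
    (ip : {dot X for idfun}) (hip : norm_induced_by ip)
    (F : X -> dual X) (L c t eta : R) (hc : 0 < c) (ht : 0 < t)
    (hL : 0 <= L) (heta : 0 <= eta) (u p w : X)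
    (F_lip : forall v : X, `|F p v - F w v| <= L * `|p - w| * `|v|)
    (F_mono : c * `|u - w| ^+ 2 <= F u (u - w) - F w (u - w))
    (hu : forall v : X, F u v = 0)
    (step : forall v : X, `|opB ip F t p v - ip w v| <= eta * `|v|) :
  `|u - w| <= eta / (t * c) + ((t * c)^-1 + L / c) * `|w - p|.
Proof.
have tc_gt0 : 0 < t * c by exact: mulr_gt0.
(* The division by the error norm below needs it to be nonzero. *)
have [->|e_neq0] := eqVneq (u - w) 0.
  by rewrite normr0 addr_ge0 // ?mulr_ge0 // ?addr_ge0 // ?mulr_ge0 //
    invr_ge0 ltW.
have e_gt0 : 0 < `|u - w| by rewrite normr_gt0.
have residual_p : - (t * F p (u - w)) <= (eta + `|w - p|) * `|u - w|.
  have -> : - (t * F p (u - w)) =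
      (opB ip F t p (u - w) - ip w (u - w)) + ip (w - p) (u - w).
    by rewrite /opB linearBl; ring.
  rewrite mulrDl lerD ?(dot_le_norm hip) //.
  exact: le_trans (ler_norm _) (step _).
have change_point : F p (u - w) - F w (u - w) <= L * `|w - p| * `|u - w|.
  by rewrite (distrC w p); exact: le_trans (ler_norm _) (F_lip _).
have key : t * c * `|u - w| <= eta + `|w - p| + t * L * `|w - p|.
  rewrite -(ler_pM2r e_gt0).
  move: F_mono; rewrite hu sub0r => /(ler_wpM2l (ltW ht)).
  move: change_point => /(ler_wpM2l (ltW ht)).
  lra.
have -> : eta / (t * c) + ((t * c)^-1 + L / c) * `|w - p| =
    (eta + `|w - p| + t * L * `|w - p|) / (t * c).
  by field; rewrite !gt_eqF.
by rewrite ler_pdivlMr // mulrC.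
Qed.

Theorem proposition2p5 (R : realType) (X : completeNormedModType R)
    (ip : {dot X for idfun}) (hip : norm_induced_by ip)
    (Xh : submodClosed X) (hXh : finite_dimensional Xh)
    (F : X -> dual X) (L c : R) (hL : 0 < L) (hc : 0 < c)
    (F_lip : forall x y v : X, `|F x v - F y v| <= L * `|x - y| * `|v|)
    (F_mono : forall x y : X,
      c * `|x - y| ^+ 2 <= F x (x - y) - F y (x - y))
    (u : X) (hu : forall v : X, F u v = 0)
    (uh : nat -> X) (huh : forall n : nat, uh n \in Xh)
    (uh_step : forall (n : nat) (vh : X), vh \in Xh ->
      ip (uh n.+1) vh = opB ip F (c / L ^+ 2) (uh n) vh)
    (eta : R) (heta : 0 <= eta)
    (eta_bound : forall (n : nat) (v : X),
      `|opB ip F (c / L ^+ 2) (uh n) v - ip (uh n.+1) v| <= eta * `|v|)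
    (n : nat) :
  `|u - uh n.+1| <=
    L ^+ 2 / c ^+ 2 * eta + L / c * (1 + L / c) * `|uh n.+1 - uh n|.
Proof.
have t_gt0 : 0 < c / L ^+ 2 by rewrite divr_gt0 ?exprn_gt0.
have := error_le_fixed_point_step hip hc t_gt0 (ltW hL) heta
  (F_lip _ _) (F_mono _ _) hu (eta_bound n).
congr (_ <= _); by field; rewrite !gt_eqF.
Qed.
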